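(* For every finite group $G$, the intersection of all weak subnormalizers in $G$ of all cyclic primary subgroups of $G$ is the hypercenter $\mathrm{Z}_\infty(G)$ of $G$.
   Context: All groups are finite. A cyclic primary subgroup is a cyclic subgroup of prime power order. A subgroup $T$ of $G$ is a weak subnormalizer of a subgroup $H$ in $G$ if $H$ is subnormal in $T$ and, whenever $H$ is subnormal in $M\le G$ and $T\le M$, then $T=M$ (it always exists but need not be unique). The hypercenter $\mathrm{Z}_\infty(G)$ is the final term of the upper central series of $G$. *)

(* Defs.v *)
From mathcomp Require Import all_boot all_fingroup all_solvable.

Set Implicit Arguments.
Unset Strict Implicit.
Unset Printing Implicit Defensive.

Local Open Scope group_scope.

Definition weak_subnormalizer (gT : finGroupType) (G H T : {group gT}) : bool :=
  [max T | (T \subset G) && (H <|<| T)].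

(* [p_group H] says that #|H| is a power of some prime; it includes H = 1,   *)
(* whose only weak subnormalizer in G is G itself.                           *)
Definition cyclic_primary (gT : finGroupType) (H : {group gT}) : bool :=
  cyclic H && p_group H.

(* The upper central series is stationary from index #|G| on; see            *)
(* [ucn_sub_hypercenter].                                                    *)
Definition hypercenter (gT : finGroupType) (G : {group gT}) : {set gT} :=
  'Z_#|G|(G).

Lemma ucn_sub_hypercenter (gT : finGroupType) (G : {group gT}) (n : nat) :
  'Z_n(G) \subset hypercenter G.
Proof.
rewrite /hypercenter; have [le_nG | /ltnW le_Gn] := leqP n #|G|.
  exact: ucn_sub_geq.
have stab m k : 'Z_m.+1(G) = 'Z_m(G) -> 'Z_(k + m)(G) = 'Z_m(G).
  by move=> eqm; elim: k => // k IHk; rewrite addSn ucnSn IHk -ucnSn.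
have grow m : 'Z_m.+1(G) = 'Z_m(G) \/ m < #|'Z_m.+1(G)|.
  elim: m => [|m [eqm | ltm]]; first by right; apply: cardG_gt0.
    by left; rewrite (stab m 2%N eqm) (stab m 1%N eqm).
  have [eqm | neqm] := eqVneq 'Z_m.+2(G) 'Z_m.+1(G); first by left.
  right; apply: leq_ltn_trans ltm _; apply: proper_card.
  by rewrite properEneq eq_sym neqm ucn_subS.
have [eqG | ltG] := grow #|G|.
  by rewrite -(subnK le_Gn) stab.
by have:= leq_trans ltG (subset_leq_card (ucn_sub _ _)); rewrite ltnn.
Qed.

(* Main.v *)
Require Import Defs.
From mathcomp Require Import all_boot all_fingroup all_solvable.

Local Open Scope group_scope.

(** Write D for the intersection.

    The hypercenter lies in D because each subgroup T of G is subnormal in its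
    join with any term of the upper central series ([subnormal_join_ucn]).  If
    H is subnormal in T, it is then subnormal in that join, so a weak
    subnormalizer T of H absorbs the whole hypercenter.

    Conversely, if x is a p-element of G and T is a weak subnormalizer of <x>,
    then the p-subgroup <x>, being subnormal in T, lies in 'O_p(T), while D lies
    in T by definition ([wsn_core_pelt]).  This has two consequences.  First,
    every p-element of D lies in 'O_p(D), so that the Sylow p-subgroups of D
    are the cores 'O_p(D) and D is generated by these.  Second, if q != p then
    Q = 'O_q(D) and 'O_p(T) normalize each other, because Q <= T and because
    D, hence Q, is normal in G; they meet trivially, so x centralizes Q.  A
    normal q-subgroup of G centralized by all elements of prime power order
    prime to q is hypercentral: G is generated by its centralizer in G and any
    single Sylow q-subgroup S, so the upper central series of the nilpotent
    group S, cut down to Q, lies in that of G ([pcentral_sub_hypercenter]). *)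

Section WeakSubnormalizer.

Set Implicit Arguments.
Unset Strict Implicit.

Variable gT : finGroupType.
Implicit Types (G H K Q T : {group gT}) (p q : nat).

(** A p-subgroup climbs its subnormal series inside the p-cores of the terms:
    the p-core of a normal subgroup lies in that of the whole group. *)
Lemma subnormal_pcore p H G : p.-group H -> H <|<| G -> H \subset 'O_p(G).
Proof.
move=> pH /subnormalP[s Hs <-{G}].
elim/last_ind: s Hs => [_ | s G IHs]; first by rewrite /= pcore_max.
rewrite -cats1 cat_path last_cat /= andbT => /andP[Hs nsKG].
apply: subset_trans (IHs Hs) _.
by rewrite pcore_max ?pcore_pgroup ?gFnormal_trans.
Qed.

(** Each step of the chain of joins is normal because [G, 'Z_n.+1(G)] lies in
    'Z_n(G). *)
Lemma subnormal_join_ucn G T n : T \subset G -> T <|<| T <*> 'Z_n(G).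
Proof.
move=> sTG; elim: n => [|n IHn]; first by rewrite ucn0 joingG1 subnormal_refl.
apply: subnormal_trans IHn (normal_subnormal _).
rewrite /normal join_subG joing_subl /=.
rewrite (subset_trans (ucn_subS n G)) ?joing_subr //=.
rewrite join_subG (subset_trans (joing_subl T 'Z_n(G))) ?normG //=.
rewrite -commg_subr (subset_trans _ (joing_subr T 'Z_n(G))) //.
apply: subset_trans (ucn_comm n G); apply: commgS.
by rewrite join_subG sTG ucn_sub.
Qed.

Lemma hypercenter_sub_wsn G H T :
  weak_subnormalizer G H T -> hypercenter G \subset T.
Proof.
case/maxgroupP=> /andP[sTG snHT] maxT.
rewrite -(maxT (T <*> 'Z_#|G|(G))%G) ?joing_subl ?joing_subr //=.
rewrite join_subG sTG ucn_sub /=.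
by apply: (@subnormal_trans _ T) snHT _; apply: subnormal_join_ucn.
Qed.

Lemma wsn_exists G H : H \subset G -> exists T, weak_subnormalizer G H T.
Proof.
move=> sHG; pose P (T : {set gT}) := (T \subset G) && (H <|<| T).
have [|T maxT _] := @maxgroup_exists _ P H; last by exists T.
by rewrite /P sHG subnormal_refl.
Qed.

Lemma subnormalJ H T g : H <|<| T -> H :^ g <|<| T :^ g.
Proof.
move=> snHT; have := morphim_subnormal (conjgm_morphism T g) snHT.
by rewrite !morphim_conj !(setIidPr _) ?(subnormal_sub snHT).
Qed.

Lemma wsnJ G H T g :
  g \in G -> weak_subnormalizer G H T -> weak_subnormalizer G (H :^ g) (T :^ g).
Proof.
move=> Gg /maxgroupP[/andP[sTG snHT] maxT]; apply/maxgroupP; split.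
  by rewrite -{1}(conjGid Gg) conjSg sTG subnormalJ.
move=> M /andP[sMG snHM] sTM.
have sMgG: M :^ g^-1 \subset G by rewrite -(conjGid (groupVr Gg)) conjSg.
rewrite /= -(maxT (M :^ g^-1)%G) ?conjsgKV //=; last by rewrite -sub_conjg.
by rewrite sMgG -(conjsgK g H) (@subnormalJ (H :^ g)%G).
Qed.

(** A Sylow q-subgroup S contains Q, and 'C_G(Q) contains the Sylow p-subgroups
    for all other primes p; so G is generated by S and 'C_G(Q), and an element
    of Q is central in a quotient of G as soon as its image commutes with that
    of S.  This carries the upper central series of S over to G inside Q. *)
Lemma pcentral_sub_hypercenter q G Q :
    q.-group Q -> Q <| G ->
    (forall p x, prime p -> p != q -> x \in G -> p.-elt x -> x \in 'C(Q)) ->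
  Q \subset hypercenter G.
Proof.
move=> qQ nsQG cQ; have [S sylS] := Sylow_exists q G.
have sSG := pHall_sub sylS.
have sQS: Q \subset S.
  by apply: subset_trans (pcore_sub_Hall sylS); apply: pcore_max.
have defG: G \subset S <*> 'C_G(Q).
  rewrite -{1}(@Sylow_transversal_gen _ [set P : {group gT} |
    (P \subset G) && (P \subset S <*> 'C_G(Q))] G).
  - by rewrite gen_subG; apply/bigcupsP=> P /[!inE] /andP[].
  - by move=> P /[!inE] /andP[].
  move=> p; rewrite mem_primes => /andP[p_pr _].
  have [-> | neq_pq] := eqVneq p q.
    by exists S; rewrite // inE sSG joing_subl.
  have [P sylP] := Sylow_exists p G; have sPG := pHall_sub sylP.
  exists P; rewrite // inE sPG /=.
  apply: subset_trans (joing_subr _ _).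
  rewrite subsetI sPG; apply/subsetP=> x Px.
  by rewrite (cQ p) ?(subsetP sPG) // (mem_p_elt (pHall_pgroup sylP)).
have sZ n: Q :&: 'Z_n(S) \subset 'Z_n(G).
  elim: n => [|n IHn]; first by rewrite !ucn0 subsetIr.
  apply/subsetP=> y /setIP[Qy Zy].
  have Gy := subsetP (normal_sub nsQG) y Qy.
  rewrite ucnSnR inE Gy /=.
  (* Modulo 'Z_n(G), the element y commutes with both S and 'C_G(Q). *)
  have nZG: G \subset 'N('Z_n(G)) := normal_norm (ucn_normal n G).
  have nZy: [set y] \subset 'N('Z_n(G)) by rewrite sub1set (subsetP nZG).
  have nZS := subset_trans sSG nZG.
  have nZC : 'C_G(Q) \subset 'N('Z_n(G)) by rewrite subIset ?nZG.
  rewrite -quotient_cents2 //.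
  rewrite centsC (subset_trans (quotientS _ defG)) // quotientY //.
  rewrite join_subG; apply/andP; split; rewrite quotient_cents2 //=.
    apply: subset_trans IHn; rewrite commGC subsetI.
    rewrite (subset_trans (commSg _ _) (ucn_comm n S)) ?sub1set // andbT.
    rewrite (subset_trans (commSg S (_ : _ \subset Q))) ?sub1set //.
    by rewrite commg_subl (subset_trans sSG) ?normal_norm.
  have /commG1P-> : 'C_G(Q) \subset 'C([set y]).
    by rewrite subIset // centS ?orbT // sub1set.
  exact: sub1G.
have nilS: nilpotent S := pgroup_nil (pHall_pgroup sylS).
apply: subset_trans (ucn_sub_hypercenter G (nil_class S)).
apply: subset_trans (sZ _); rewrite subsetI subxx.
by have /(ucn_nil_classP _ nilS)-> := leqnn (nil_class S).
Qed.

Definition wsn_core G : {set gT} :=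
  \bigcap_(H : {group gT} | (H \subset G) && cyclic_primary H)
    \bigcap_(T : {group gT} | weak_subnormalizer G H T) (T : {set gT}).

Canonical wsn_core_group G := Eval hnf in [group of wsn_core G].

Lemma wsn_core_pelt p G x :
    prime p -> x \in G -> p.-elt x ->
  exists T, [/\ T \subset G, x \in 'O_p(T) & wsn_core G \subset T].
Proof.
move=> p_pr Gx px; have sxG: <[x]> \subset G by rewrite cycle_subG.
have [T wsnT] := wsn_exists sxG; have /andP[sTG snxT] := maxgroupp wsnT.
exists T; split=> //.
  by rewrite -cycle_subG subnormal_pcore.
apply: subset_trans (bigcap_inf <[x]>%G _) (bigcap_inf T wsnT).
by rewrite sxG /cyclic_primary cycle_cyclic (pgroup_p px).
Qed.

(** Conjugation by elements of G permutes the pairs formed by a cyclic primary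
    subgroup and one of its weak subnormalizers ([wsnJ]). *)
Lemma wsn_core_normal G : wsn_core G <| G.
Proof.
have sDG: wsn_core G \subset G.
  (* The trivial element puts at least one subgroup of G in the intersection. *)
  have [T [sTG _ sDT]] := @wsn_core_pelt 2 G 1 isT (group1 G) (p_elt1 _ _).
  exact: subset_trans sDT sTG.
rewrite /normal sDG; apply/subsetP=> g Gg; rewrite inE.
apply/subsetP=> _ /imsetP[y Dy ->]; apply/bigcapP=> H /andP[sHG /andP[cH pH]].
apply/bigcapP=> T wsnT; rewrite -mem_conjgV.
have Gg' := groupVr Gg; have /bigcapP/(_ (H :^ g^-1)%G) := Dy.
have -> : (H :^ g^-1)%G \subset G by rewrite -(conjGid Gg') conjSg.
rewrite /cyclic_primary cyclicJ cH /p_group cardJg pgroupJ -/(p_group H) pH.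
by move=> /(_ isT) /bigcapP/(_ (T :^ g^-1)%G); apply; apply: wsnJ.
Qed.

Lemma pcore_wsn_core_sub_hypercenter q G :
  'O_q(wsn_core G) \subset hypercenter G.
Proof.
have nsQG: 'O_q(wsn_core G) <| G by rewrite gFnormal_trans ?wsn_core_normal.
apply: (pcentral_sub_hypercenter (pcore_pgroup q _) nsQG) => p x p_pr.
move=> neq_pq Gx px.
have [T [sTG OTx sDT]] := wsn_core_pelt p_pr Gx px.
have sQT := subset_trans (pcore_sub q (wsn_core G)) sDT.
suff: <[x]> \subset 'C('O_q(wsn_core G)) by rewrite cycle_subG.
apply: (subset_trans (_ : _ \subset 'O_p(T))); first by rewrite cycle_subG.
apply/commG1P/trivgP.
have tiQO: 'O_p(T) :&: 'O_q(wsn_core G) = 1.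
  apply: coprime_TIg; apply: pnat_coprime (pcore_pgroup p T) _.
  apply: sub_pgroup (pcore_pgroup q _) => r; rewrite !inE => /eqP->.
  by rewrite eq_sym.
rewrite -tiQO commg_subI // subsetI subxx.
  by rewrite (subset_trans (pcore_sub _ _)) // (subset_trans sTG) ?normal_norm.
by rewrite (subset_trans sQT) // normal_norm ?pcore_normal.
Qed.

Lemma wsn_core_sub_hypercenter G : wsn_core G \subset hypercenter G.
Proof.
have sDG := normal_sub (wsn_core_normal G).
rewrite -(Sylow_gen (wsn_core_group G)) gen_subG.
apply/bigcupsP=> P /SylowP[p p_pr sylP].
apply: subset_trans (pcore_wsn_core_sub_hypercenter p G).
apply/subsetP=> x Px; have Dx := subsetP (pHall_sub sylP) x Px.
have px := mem_p_elt (pHall_pgroup sylP) Px.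
have [T [sTG OTx sDT]] := wsn_core_pelt p_pr (subsetP sDG x Dx) px.
suff sOI: wsn_core G :&: 'O_p(T) \subset 'O_p(wsn_core G).
  by rewrite (subsetP sOI) // inE Dx.
rewrite pcore_max ?(pgroupS (subsetIr _ _)) ?pcore_pgroup //.
exact: normalGI sDT (pcore_normal p T).
Qed.

End WeakSubnormalizer.

Theorem corollary1p5 (gT : finGroupType) (G : {group gT}) :
  \bigcap_(H : {group gT} | (H \subset G) && cyclic_primary H)
    \bigcap_(T : {group gT} | weak_subnormalizer G H T) (T : {set gT})
  = hypercenter G.
Proof.
apply/eqP; rewrite eqEsubset wsn_core_sub_hypercenter /=.
apply/bigcapsP=> H _; apply/bigcapsP=> T; exact: hypercenter_sub_wsn.
Qed.
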